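(* Let $\mathbf{u}$ be a (right-sided infinite) sequence over a finite alphabet. Then $r_{\mathbf{u}}(n+2)=r_{\mathbf{u}}(n)+1$ for every $n\in\mathbb{N}$ if and only if one of the following holds: \begin{itemize} \item $\mathbf{u}$ is a Sturmian sequence; or \item there exist a Sturmian sequence $\mathbf{v}$ over a two-letter alphabet $\{a,b\}$ and a letter $c\notin\{a,b\}$ such that $\mathbf{u}=\pi(\mathbf{v})$ or $\mathbf{u}=c\,\pi(\mathbf{v})$, where $\pi$ is the morphism given by $\pi: a\mapsto ac,\ b\mapsto bc$. \end{itemize}
   Context: $\mathbb{N}$ includes $0$. For a sequence $\mathbf{u}=u_0u_1u_2\cdots$ over a finite alphabet, $\mathcal{L}_n(\mathbf{u})=\{u_iu_{i+1}\cdots u_{i+n-1} : i\in\mathbb{N}\}$ is the set of factors of $\mathbf{u}$ of length $n$ (for $n=0$ it consists of the empty word only), and $\mathcal{C}_{\mathbf{u}}(n)=\#\mathcal{L}_n(\mathbf{u})$ is its factor complexity. A sequence $\mathbf{u}$ is Sturmian if $\mathcal{C}_{\mathbf{u}}(n)=n+1$ for every $n\in\mathbb{N}$. The reversal of a word $w=w_0w_1\cdots w_{n-1}$ is $\overline{w}=w_{n-1}\cdots w_1w_0$. Two words $u,v$ are (reflectively) equivalent, $u\sim_r v$, if $u=v$ or $u=\overline{v}$. The reflection complexity of $\mathbf{u}$ is the map $r_{\mathbf{u}}:\mathbb{N}\to\mathbb{N}$ where $r_{\mathbf{u}}(n)$ is the number of distinct elements of $\mathcal{L}_n(\mathbf{u})$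 up to the equivalence $\sim_r$. A morphism $\psi$ of finite words (a map with $\psi(uv)=\psi(u)\psi(v)$) is extended to sequences by $\psi(u_0u_1u_2\cdots)=\psi(u_0)\psi(u_1)\psi(u_2)\cdots$. *)

(* Defs.v *)
From mathcomp Require Import all_boot.
From mathcomp Require Import boolp.

Set Implicit Arguments.
Unset Strict Implicit.
Unset Printing Implicit Defensive.

Section Words.
Variable A : finType.
Implicit Types (u v : nat -> A) (w : seq A).

Definition factor_at u (i n : nat) : n.-tuple A := [tuple u (i + j) | j < n].

Definition factors u (n : nat) : {set n.-tuple A} :=
  [set w : n.-tuple A | `[< exists i, w = factor_at u i n >]].

Definition factor_complexity u (n : nat) : nat := #|factors u n|.

Definition sturmian u : Prop := forall n, factor_complexity u n = n + 1.

Definition refl_equiv (w w' : seq A) : bool := (w == w') || (w == rev w').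

Definition reflection_complexity u (n : nat) : nat :=
  #|equivalence_partition
      (fun w w' : n.-tuple A => refl_equiv w w') (factors u n)|.

(* [psi] gives the images of the letters, which determine the morphism. *)
Definition morph (psi : A -> seq A) w : seq A := flatten (map psi w).

(* The extension psi(v_0) psi(v_1) ... to sequences, meaningful when no letter
   is erased: then psi(v_0 ... v_n) has more than n letters, so that the default
   value of [nth] is never used; see [morph_seq_prefix]. *)
Definition morph_seq (psi : A -> seq A) v : nat -> A :=
  fun n => nth (v 0) (morph psi (mkseq v n.+1)) n.

Definition scons (c : A) u : nat -> A :=
  fun n => if n is m.+1 then u m else c.

(* Used on words over two letters a, b distinct from c: a |-> ac, b |-> bc. *)
Definition pi_morph (c x : A) : seq A := [:: x; c].

Lemma size_morph_mkseq (psi : A -> seq A) v n :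
  (forall x, psi x != [::]) -> n <= size (morph psi (mkseq v n)).
Proof.
move=> psi_neq0; elim: n => // n IHn.
rewrite mkseqS /morph map_rcons flatten_rcons size_cat -addn1 leq_add //.
by rewrite lt0n size_eq0.
Qed.

Lemma morph_mkseqD (psi : A -> seq A) v m n :
  morph psi (mkseq v (m + n)) =
    morph psi (mkseq v m) ++ morph psi (mkseq (fun j => v (m + j)) n).
Proof.
rewrite /morph -flatten_cat -map_cat; congr (flatten (map _ _)).
by rewrite /mkseq iotaD map_cat add0n -[in X in _ ++ X](addn0 m) iotaDl -map_comp.
Qed.

Lemma morph_seq_prefix (psi : A -> seq A) v n :
    (forall x, psi x != [::]) ->
  mkseq (morph_seq psi v) (size (morph psi (mkseq v n)))
    = morph psi (mkseq v n).
Proof.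
move=> psi_neq0; apply: (@eq_from_nth _ (v 0)); rewrite size_mkseq // => i lti.
rewrite nth_mkseq // /morph_seq.
have [lein | ltni] := leqP i.+1 n.
  by rewrite -(subnKC lein) morph_mkseqD nth_cat size_morph_mkseq.
by rewrite -(subnKC (ltnW ltni)) morph_mkseqD nth_cat lti.
Qed.

End Words.

(* Main.v *)
Require Import Defs.
From mathcomp Require Import all_boot.
From mathcomp Require Import boolp zify.

(** Write C, r and P for the number of factors of a given length, of their
classes up to reversal, and of the palindromes among them.

Everything rests on counting. If L is the set of factors of length n, then the
union of L and its reversal has 2 r(n) - P(n) elements
([double_reflection_complexity]), and this is C(n) exactly when L is closed
under reversal. A sequence that is not eventually periodic has C(n) > n and a
right special factor of every length; as long as C grows by one, this right
special factor is unique and has exactly two right extensions. This uniqueness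
controls palindromes: when L is closed under reversal, every palindrome w has
an extension x w x ([palindrome_extension]), and only one
([palindrome_extension_uniq]), so that P(n + 2) = P(n).

Sturmian sequences satisfy r(n + 2) = r(n) + 1. The main point is that their
sets of factors are closed under reversal ([sturmian_rev_closed]). By induction
on the length this could only fail at a palindrome w with x w x, x w y and y w y
among the factors but not y w x; but then, after an occurrence of y w y, the
unique right special factor x w stays away for so long that the sequence falls
into a loop ([unbalanced_periodic]). Then 2 r = C + P, with C(n) = n + 1 and
P(n + 2) = P(n), gives the relation.

Conversely this relation makes r unbounded, so u is not eventually periodic,
and gives r(2) = 2: the unordered pairs of adjacent letters form a connected
graph with two edges. If one edge is a loop there are two letters; otherwise the
graph is a path a - c - b, and every other letter of u is c
([letters_dichotomy]). For two letters, assume by induction that C(k) = k + 1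
and closure under reversal hold for k = n and k = n + 1. Then P(n) <= P(n + 2),
and 2 r(n + 2) - P(n + 2) <= 2 r(n) + 2 - P(n) = n + 3; as C(n + 2) is at least
n + 3, both properties pass to n + 2 ([binary_sturmian]).

For three letters, u is obtained from a sequence v on a and b by inserting c in
every other place. A nonempty factor of even length starts or ends with c, but
not both, so up to reversal it starts with a letter of v, and distinct factors
of v of length m give distinct classes of length 2m: hence C_v(m) is at most
r_u(2m) = m + 1, and v is Sturmian ([weave_sturmian]). When v is Sturmian,
recurrence of v and closure under reversal turn this into r_u(2m) = C_v(m) and
r_u(2m + 1) = r_v(m) + r_v(m + 1), and the relation for v gives that for u
([weave_sturmian_reflection]). *)

Set Implicit Arguments.
Unset Strict Implicit.
Unset Printing Implicit Defensive.

(** * Counting classes of an equivalence *)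

Section Classes.
Variable T : finType.
Implicit Type D : {set T}.

Lemma card_imset_classes (T1 : finType) D (g : T -> T1) :
  #|g @: D| = #|equivalence_partition (fun x y => g x == g y) D|.
Proof.
have -> : equivalence_partition (fun x y => g x == g y) D =
    (fun z => [set y in D | z == g y]) @: (g @: D) by rewrite -imset_comp.
rewrite [RHS]card_in_imset // => _ _ /imsetP[x xD ->] /imsetP[y yD ->] /setP/(_ x).
by rewrite !inE xD eqxx /= => /esym/eqP.
Qed.

End Classes.

Section Counting.
Variables (T T1 T2 : finType).
Implicit Type D : {set T}.

(** The size of an image depends only on which elements are identified, so that
classes can be counted through any function that separates them. *)
Lemma card_imset_kernel D (g : T -> T1) (h : T -> T2) :
  {in D &, forall x y, (g x == g y) = (h x == h y)} -> #|g @: D| = #|h @: D|.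
Proof.
move=> gh; rewrite (card_imset_classes D g) (card_imset_classes D h).
rewrite (_ : equivalence_partition (fun x y => g x == g y) D =
             equivalence_partition (fun x y => h x == h y) D) //.
apply: eq_in_imset => x xD; apply/setP => y.
by rewrite !inE; case: (boolP (y \in D)) => //= yD; rewrite gh.
Qed.

(** Removing p1 and p2 from D does not shrink the image, since q1 and q2 stay. *)
Lemma imset_excess2 D (f : T -> T1) p1 p2 q1 q2 :
    p1 != p2 -> p1 \in D -> p2 \in D ->
    q1 \in D :\: [set p1; p2] -> q2 \in D :\: [set p1; p2] ->
    f q1 = f p1 -> f q2 = f p2 ->
  #|f @: D| + 2 <= #|D|.
Proof.
move=> np p1D p2D q1D q2D fq1 fq2.
have sD : [set p1; p2] \subset D by rewrite subUset !sub1set p1D p2D.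
rewrite -(cardsID [set p1; p2] D) (setIidPr sD) cards2 np addnC leq_add2l.
apply: leq_trans (leq_imset_card f _); apply: subset_leq_card.
apply/subsetP => _ /imsetP[x xD ->].
have [->|n1] := eqVneq x p1; first by rewrite -fq1 imset_f.
have [->|n2] := eqVneq x p2; first by rewrite -fq2 imset_f.
by rewrite imset_f // !inE negb_or n1 n2.
Qed.

End Counting.

(** * Factors and periodicity *)

Definition window (A : Type) (u : nat -> A) i n := mkseq (fun j => u (i + j)) n.

Definition is_factor (A : Type) (u : nat -> A) (w : seq A) :=
  exists i, w = window u i (size w).

Definition eventually_periodic (A : Type) (u : nat -> A) :=
  exists N p, 0 < p /\ forall k, u (N + (k + p)) = u (N + k).

Section Factors.
Variable A : finType.
Implicit Types (u v : nat -> A) (w : seq A) (x y z : A).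

Lemma window_rcons u i n : window u i n.+1 = rcons (window u i n) (u (i + n)).
Proof. exact: mkseqS. Qed.

Lemma window_cons u i n : window u i n.+1 = u i :: window u i.+1 n.
Proof.
rewrite /window /mkseq /= addn0 (iotaDl 1 0) -map_comp.
by congr (_ :: _); apply: eq_map => j /=; rewrite addnA addn1.
Qed.

Lemma size_window u i n : size (window u i n) = n.
Proof. exact: size_mkseq. Qed.

Lemma nth_window x u i n j : j < n -> nth x (window u i n) j = u (i + j).
Proof. exact: nth_mkseq. Qed.

Lemma val_factor_at u i n : factor_at u i n = window u i n :> seq A.
Proof. by rewrite /= /window /mkseq -val_enum_ord -map_comp. Qed.

Lemma mem_factors u n (t : n.-tuple A) : t \in factors u n <-> is_factor u t.
Proof.
rewrite inE; split=> [/asboolP[i ->]|[i ti]].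
  by exists i; rewrite size_tuple val_factor_at.
by apply/asboolP; exists i; apply: val_inj; rewrite [LHS]ti [RHS]val_factor_at size_tuple.
Qed.

Lemma factor_window u i n : is_factor u (window u i n).
Proof. by exists i; rewrite size_window. Qed.

Lemma factor_belast u w x : is_factor u (rcons w x) -> is_factor u w.
Proof.
case=> i; rewrite size_rcons window_rcons => /rcons_inj[-> _].
exact: factor_window.
Qed.

Lemma factor_behead u w x : is_factor u (x :: w) -> is_factor u w.
Proof.
case=> i /=; rewrite window_cons => -[_ ->]; exact: factor_window.
Qed.

Lemma factor_rext u w : is_factor u w -> exists x, is_factor u (rcons w x).
Proof.
case=> i wi; exists (u (i + size w)); exists i.
by rewrite size_rcons window_rcons -wi.
Qed.

(** The window of length n moves along the sequence. If it returns at j to its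
content at i, and if on the way each content determines the next letter, then
the loop from i to j is repeated forever. *)
Lemma determined_periodic u n i j :
    i < j -> window u i n = window u j n ->
    (forall l m, i <= l < j -> window u m n = window u l n ->
      u (m + n) = u (l + n)) ->
  eventually_periodic u.
Proof.
move=> ij eqij det; set p := j - i; have p_gt0 : 0 < p by rewrite subn_gt0.
have detp k : window u (i + k) n = window u (i + k %% p) n ->
    u (i + k + n) = u (i + k %% p + n).
  by move=> e; apply: det => //; have := ltn_pmod k p_gt0; rewrite /p; lia.
have shiftW a b : window u a n = window u b n -> u (a + n) = u (b + n) ->
    window u a.+1 n = window u b.+1 n.
  move=> e1 e2; have := window_rcons u a n; have := window_rcons u b n.
  by rewrite !window_cons e1 e2 => <- [].
(* Position i + k shows the same window as its representative in [i, j). *)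
have per k : window u (i + k) n = window u (i + k %% p) n.
  elim: k => [|k IHk]; first by rewrite mod0n.
  have := shiftW _ _ IHk (detp _ IHk); rewrite -!addnS => ->.
  rewrite -[in RHS]addn1 -modnDml addn1.
  have : (k %% p).+1 <= p by rewrite ltn_mod.
  rewrite leq_eqVlt => /predU1P[->|lt]; last by rewrite (modn_small lt).
  by rewrite modnn addn0 [X in window u X](_ : _ = j) //; rewrite /p; lia.
exists (i + n), p; split=> // k.
have e l : u (i + n + l) = u (i + n + l %% p).
  by rewrite ![i + n + _]addnAC (detp _ (per _)).
by rewrite e modnDr -e.
Qed.

Lemma periodic_bounded u :
  eventually_periodic u -> exists B, forall n, factor_complexity u n <= B.
Proof.
case=> N [p [p_gt0 per]]; exists (N + p) => n.
have perk k m : u (N + (m + k * p)) = u (N + m).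
  elim: k => [|k IHk]; first by rewrite addn0.
  by rewrite mulSn [p + _]addnC (addnA m) per.
rewrite /factor_complexity.
have -> : factors u n = [set factor_at u (i : 'I_(N + p)) n | i in 'I_(N + p)].
  apply/setP => t; rewrite inE; apply/asboolP/imsetP => [[i ->]|[i _ ->]].
    case: (ltnP i (N + p)) => [lti|gei]; first by exists (Ordinal lti).
    have lti : N + (i - N) %% p < N + p by rewrite ltn_add2l ltn_mod.
    exists (Ordinal lti) => //; apply: val_inj.
    rewrite [LHS]val_factor_at [RHS]val_factor_at.
    apply: eq_mkseq => j /=.
    rewrite -addnA -(perk ((i - N) %/ p)); congr u.
    by have := divn_eq (i - N) p; lia.
  by exists i.
by rewrite -[leqRHS]card_ord leq_imset_card.
Qed.

Definition prefix_tuple n (t : n.+1.-tuple A) : n.-tuple A :=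
  [tuple of belast (thead t) (behead t)].

Lemma prefix_tuple_rcons n (t : n.-tuple A) x :
  prefix_tuple [tuple of rcons t x] = t.
Proof.
apply: val_inj => /=; set r := [tuple of rcons t x].
have : belast x (val r) = x :: t by rewrite /= belast_rcons.
rewrite (tuple_eta r) /= => -[e].
by rewrite {}e.
Qed.

Lemma factors_prefix u n : @prefix_tuple n @: factors u n.+1 = factors u n.
Proof.
apply/setP => t; apply/imsetP/idP => [[s] + ->|].
  rewrite inE => /asboolP[i ->]; apply/mem_factors.
  have -> : factor_at u i n.+1 = [tuple of rcons (factor_at u i n) (u (i + n))].
    by apply: val_inj; rewrite [LHS]val_factor_at window_rcons -val_factor_at.
  rewrite prefix_tuple_rcons val_factor_at; exact: factor_window.
move=> /mem_factors/factor_rext[x Fx]; exists [tuple of rcons t x].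
  exact/mem_factors.
by rewrite prefix_tuple_rcons.
Qed.

End Factors.

(** * Right special factors *)

Lemma pigeonhole (T : finType) (S : {set T}) (f : nat -> T) N :
    (forall i, i < N -> f i \in S) -> #|S| < N ->
  exists i j, i < j < N /\ f i = f j.
Proof.
move=> fS ltSN; have /injectivePn[i [j nij eij]] :
    ~~ injectiveb (fun i : 'I_N => f i).
  apply/negP => /injectiveP/(card_imset [set: 'I_N]) /esym; rewrite cardsT card_ord.
  apply/eqP; rewrite gtn_eqF // (leq_ltn_trans _ ltSN) // subset_leq_card //.
  by apply/subsetP => _ /imsetP[i _ ->]; apply: fS.
case: (ltngtP i j) nij => [lt|lt|/val_inj->]; last by rewrite eqxx.
  by exists i, j; rewrite lt ltn_ord.
by exists j, i; rewrite lt ltn_ord.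
Qed.

Definition right_special (A : eqType) (u : nat -> A) (w : seq A) :=
  exists x y, [/\ x != y, is_factor u (rcons w x) & is_factor u (rcons w y)].

Definition rev_closed (A : Type) (u : nat -> A) n :=
  forall w, size w = n -> is_factor u w -> is_factor u (rev w).

Section Special.
Variable A : finType.
Implicit Types (u v : nat -> A) (w : seq A) (x y z : A).

Lemma determined_special u n l m :
    ~ right_special u (window u l n) -> window u m n = window u l n ->
  u (m + n) = u (l + n).
Proof.
move=> nrs e; apply/eqP/negPn/negP => ne; apply: nrs.
exists (u (m + n)), (u (l + n)); split=> //; rewrite -?window_rcons;
  first rewrite -e -window_rcons; exact: factor_window.
Qed.

(** Otherwise every window of length n determines the next letter, and two of
the first windows coincide. *)
Lemma aperiodic_right_special u n :
  ~ eventually_periodic u -> exists2 w, size w = n & right_special u w.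
Proof.
move=> nper; apply/not_exists2P => nrs; apply: nper.
have [|i [j [/andP[ij _] eij]]] :=
  @pigeonhole _ [set: n.-tuple A] (fun i => factor_at u i n) _ _ (ltnSn _).
  by move=> *; rewrite inE.
apply: (@determined_periodic _ u n i j) => // [|l m _].
  by rewrite -!val_factor_at eij.
apply: determined_special; have [|//] := nrs (window u l n).
by rewrite size_window.
Qed.

Lemma complexity_ltS u n :
  ~ eventually_periodic u -> factor_complexity u n < factor_complexity u n.+1.
Proof.
move=> /(aperiodic_right_special n)[w wn [x [y [nxy Fx Fy]]]].
rewrite /factor_complexity -factors_prefix ltn_neqAle leq_imset_card andbT.
move/eqP: wn => wn; pose t := Tuple wn.
apply/negP => /imset_injP inj; move/eqP: nxy; apply.
have e : [tuple of rcons t x] = [tuple of rcons t y].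
  by apply: inj; rewrite ?prefix_tuple_rcons //; apply/mem_factors.
by have /rcons_inj[] := congr1 val e.
Qed.

(** The Morse-Hedlund theorem. *)
Lemma complexity_ge u n : ~ eventually_periodic u -> n < factor_complexity u n.
Proof.
move=> nper; elim: n => [|n IHn]; last exact: leq_ltn_trans (complexity_ltS n nper).
apply/card_gt0P; exists (factor_at u 0 0).
by apply/mem_factors; rewrite val_factor_at; apply: factor_window.
Qed.

(** Each right special word of length n contributes at least one to
C(n + 1) - C(n). *)
Lemma right_special_uniq u n w w' :
    factor_complexity u n.+1 <= (factor_complexity u n).+1 ->
    size w = n -> size w' = n -> right_special u w -> right_special u w' ->
  w = w'.
Proof.
move=> leC wn wn' [x [y [nxy Fx Fy]]] [x' [y' [nxy' Fx' Fy']]].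
apply/eqP/negPn/negP => nww'.
move/eqP: wn => wn; move/eqP: wn' => wn'; pose t := Tuple wn; pose t' := Tuple wn'.
have ntt' z z' : rcons w z != rcons w' z' by rewrite eqseq_rcons (negPf nww').
have ntz w0 z z' : z != z' -> rcons w0 z != rcons w0 z'.
  by rewrite eqseq_rcons eqxx.
suff : factor_complexity u n + 2 <= factor_complexity u n.+1 by lia.
rewrite /factor_complexity -(factors_prefix u n).
apply: (@imset_excess2 _ _ _ _ [tuple of rcons t x] [tuple of rcons t' x']
  [tuple of rcons t y] [tuple of rcons t' y']);
  rewrite ?prefix_tuple_rcons //; try exact/mem_factors.
- exact: ntt'.
- by rewrite in_setD in_set2 negb_or -!val_eqE /= ntt' (eq_sym (rcons w y)) ntz //=;
    apply/mem_factors.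
- by rewrite in_setD in_set2 negb_or -!val_eqE /= (eq_sym _ (rcons w x)) ntt'
    (eq_sym (rcons w' y')) ntz //=; apply/mem_factors.
Qed.

(** A third right extension would contribute one more to C(n + 1) - C(n). *)
Lemma right_special_ext u n w x y z :
    factor_complexity u n.+1 <= (factor_complexity u n).+1 ->
    size w = n -> x != y -> is_factor u (rcons w x) -> is_factor u (rcons w y) ->
  is_factor u (rcons w z) -> z = x \/ z = y.
Proof.
move=> leC wn nxy Fx Fy Fz.
have [->|nzx] := eqVneq z x; first by left.
have [->|nzy] := eqVneq z y; first by right.
move/eqP: wn => wn; pose t := Tuple wn.
suff : factor_complexity u n + 2 <= factor_complexity u n.+1 by lia.
rewrite /factor_complexity -(factors_prefix u n).
have ntz a b : a != b -> rcons w a != rcons w b by rewrite eqseq_rcons eqxx.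
have zD : [tuple of rcons t z] \in
    factors u n.+1 :\: [set [tuple of rcons t x]; [tuple of rcons t y]].
  by rewrite in_setD in_set2 negb_or -!val_eqE /= !ntz //=; apply/mem_factors.
apply: (@imset_excess2 _ _ _ _ [tuple of rcons t x] [tuple of rcons t y]
  [tuple of rcons t z] [tuple of rcons t z]);
  rewrite ?prefix_tuple_rcons //; try exact/mem_factors.
exact: ntz.
Qed.

Lemma rev_closed_pred u n : rev_closed u n.+1 -> rev_closed u n.
Proof.
move=> cl w wn /factor_rext[x] /cl; rewrite size_rcons wn rev_rcons => /(_ erefl).
exact: factor_behead.
Qed.

Definition palindromes u n : {set n.-tuple A} :=
  [set w in factors u n | rev w == w].

(** Take a right special word x w' of length n + 1. If w' = w, then x w gives
w x by reversal, so x is one of the two right extensions of w, and both of them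
also follow x w. If w' is not w, then w is not right special: its only right
extension a gives a w by reversal, and a w can only be followed by a. *)
Lemma palindrome_extension u n w :
    ~ eventually_periodic u ->
    factor_complexity u n.+1 <= (factor_complexity u n).+1 ->
    rev_closed u n.+1 -> size w = n -> is_factor u w -> rev w = w ->
  exists x, is_factor u (x :: rcons w x).
Proof.
move=> nper leC cl wn Fw pal.
have revx x : is_factor u (rcons w x) -> is_factor u (x :: w).
  by move/cl; rewrite size_rcons wn rev_rcons pal; apply.
have revx' x : is_factor u (x :: w) -> is_factor u (rcons w x).
  by move/cl; rewrite /= wn rev_cons pal; apply.
have [[//|x w'] /= [wn'] [y [z [nyz Fy Fz]]]] := aperiodic_right_special n.+1 nper.
have rs' : right_special u w'.
  by exists y, z; split=> //; [move: Fy | move: Fz]; apply: factor_behead.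
have [ew|nww'] := eqVneq w' w.
  subst w'; have Fx : is_factor u (rcons w x).
    by apply: revx'; apply: factor_belast Fy.
  have := right_special_ext leC wn nyz _ _ Fx.
  case; try exact: factor_behead.
  - by move: Fy => /factor_behead.
  - by move: Fz => /factor_behead.
  - by move=> e; exists x; rewrite {2}e.
  - by move=> e; exists x; rewrite {2}e.
have [a Fa] := factor_rext Fw; exists a.
have [b Fb] := factor_rext (revx _ Fa).
have [e|nab] := eqVneq b a; first by rewrite e in Fb.
case/eqP: nww'; apply: (right_special_uniq leC) => //.
exists b, a; split=> //; exact: factor_behead Fb.
Qed.

End Special.

(** * Reflection classes and palindromes *)

Section Reflection.
Variable A : finType.
Implicit Types (u v : nat -> A) (w : seq A) (x y z : A).

Definition rev_t n (t : n.-tuple A) : n.-tuple A := [tuple of rev t].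

(** The reflection class as a set of words, so that classes can be counted as
values of a function. *)
Definition refl_class n (t : n.-tuple A) : {set n.-tuple A} := [set t; rev_t t].

Lemma rev_tK n : involutive (@rev_t n).
Proof. by move=> t; apply: val_inj; rewrite /= revK. Qed.

Lemma mem_rev_imset n (L : {set n.-tuple A}) t :
  (t \in @rev_t n @: L) = (rev_t t \in L).
Proof. by rewrite -{1}[t]rev_tK; apply/mem_imset/inv_inj/rev_tK. Qed.

Lemma refl_class_rev n (t : n.-tuple A) : refl_class (rev_t t) = refl_class t.
Proof. by rewrite /refl_class rev_tK setUC. Qed.

Lemma refl_classE n (s t : n.-tuple A) : (refl_class s == refl_class t) = refl_equiv s t.
Proof.
apply/eqP/orP => [e|[/eqP/val_inj->|/eqP e]] //.
  have : s \in refl_class t by rewrite -e in_set2 eqxx.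
  by rewrite in_set2 -!val_eqE => /orP.
by rewrite (_ : s = rev_t t) ?refl_class_rev //; apply: val_inj.
Qed.

Lemma reflection_complexityE u n :
  reflection_complexity u n = #|@refl_class n @: factors u n|.
Proof.
rewrite card_imset_classes /reflection_complexity.
congr (#|pred_of_set (equivalence_partition _ _)|).
by do 2 apply/funext => ?; rewrite refl_classE.
Qed.

Lemma reflection_complexity_le u n : reflection_complexity u n <= factor_complexity u n.
Proof. by rewrite reflection_complexityE leq_imset_card. Qed.

(** Count each word once, and each palindrome once more: every reflection class
then contributes 2, whether it has one element or two. *)
Lemma double_reflection_complexity u n :
  2 * reflection_complexity u n =
    #|factors u n :|: @rev_t n @: factors u n| + #|palindromes u n|.
Proof.
set L := factors u n; set D := L :|: _.
have revD t : (rev_t t \in D) = (t \in D).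
  by rewrite !in_setU !mem_rev_imset rev_tK orbC.
rewrite reflection_complexityE.
have -> : @refl_class n @: L = @refl_class n @: D.
  apply/eqP; rewrite eqEsubset imsetS ?subsetUl //=.
  apply/subsetP => _ /imsetP[t + ->].
  rewrite inE => /orP[/(imset_f _)//|/imsetP[s sL ->]].
  by rewrite refl_class_rev imset_f.
have -> : #|palindromes u n| = \sum_(t in D) (rev_t t == t).
  rewrite -sum1_card big_mkcond [RHS]big_mkcond /=; apply: eq_bigr => t _.
  rewrite in_setU [t \in palindromes _ _]inE mem_rev_imset.
  rewrite -[rev t == t]/(rev_t t == t) -/L.
  have [e|_] := eqVneq (rev_t t) t; last by rewrite andbF; case: ifP.
  by rewrite e orbb andbT.
rewrite -[#|D|]sum1_card -big_split /= (partition_big_imset (@refl_class n)) /=.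
rewrite mulnC -sum_nat_const; apply: eq_bigr => _ /imsetP[t tD ->].
rewrite (eq_bigl (fun s => s \in refl_class t)) => [|s]; last first.
  rewrite refl_classE /refl_equiv in_set2 -!val_eqE /=.
  case: (boolP (_ || _)) => [/orP[/eqP/val_inj->|/eqP e]|_]; rewrite ?andbF ?andbT //.
  have -> : s = rev_t t by apply: val_inj.
  by rewrite revD tD.
have [e|ne] := eqVneq (rev_t t) t.
  by rewrite /refl_class e setUid big_set1 e eqxx.
have nt : t \notin [set rev_t t] by rewrite in_set1 eq_sym.
by rewrite /refl_class big_setU1 //= big_set1 rev_tK (negPf ne) eq_sym (negPf ne).
Qed.

Lemma rev_closedP u n : rev_closed u n <-> @rev_t n @: factors u n \subset factors u n.
Proof.
split=> [cl|/subsetP sL w wn Fw].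
  apply/subsetP => _ /imsetP[t /mem_factors Ft ->]; apply/mem_factors.
  by apply: cl => //; rewrite size_tuple.
move/eqP: wn => wn; have := sL (rev_t (Tuple wn)).
by case/(_ _)/mem_factors => [|i ri]; [apply/imset_f/mem_factors | exists i].
Qed.

Lemma double_reflection_complexity_closed u n : rev_closed u n ->
  2 * reflection_complexity u n = factor_complexity u n + #|palindromes u n|.
Proof.
by move=> /rev_closedP/setUidPl e; rewrite double_reflection_complexity e.
Qed.

(** The criterion by which closure under reversal is obtained from counting. *)
Lemma rev_closed_card u n :
  #|factors u n :|: @rev_t n @: factors u n| <= factor_complexity u n -> rev_closed u n.
Proof.
move=> le; apply/rev_closedP/setUidPl/esym/eqP.
by rewrite eqEcard subsetUl.
Qed.

End Reflection.

(** * Palindromic extensions *)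

Section Palindromes.
Variable A : finType.
Implicit Types (u v : nat -> A) (w : seq A) (x y z : A).

Definition middle_tuple n (t : n.+2.-tuple A) : n.-tuple A :=
  prefix_tuple (behead_tuple t : n.+1.-tuple A).

Lemma middle_tuple_cons n (t : n.+2.-tuple A) x w y :
  t = x :: rcons w y :> seq A -> middle_tuple t = w :> seq A.
Proof.
move=> e.
have sw : size w == n by have := size_tuple t; rewrite e /= size_rcons => -[->].
have eb : behead_tuple t = [tuple of rcons (Tuple sw) y] :> n.+1.-tuple A.
  by apply: val_inj; rewrite /= e.
by rewrite [LHS](congr1 (fun s => tval (prefix_tuple s)) eb) prefix_tuple_rcons.
Qed.

Lemma palindrome_split n (t : n.+2.-tuple A) : rev t = t ->
  exists x w, t = x :: rcons w x :> seq A /\ rev w = w.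
Proof.
case: t => -[//|x s] /= sn; case/lastP: s sn => [//|w y] _.
by rewrite rev_cons rev_rcons => -[<- /rcons_inj[e]]; exists y, w.
Qed.

Lemma middle_palindrome u n :
  @middle_tuple n @: palindromes u n.+2 \subset palindromes u n.
Proof.
apply/subsetP => _ /imsetP[t + ->]; rewrite inE => /andP[/mem_factors Ft /eqP].
move=> /palindrome_split[x [w [e pal]]].
have em := middle_tuple_cons e.
rewrite inE; apply/andP; split; last by rewrite em pal.
by apply/mem_factors; rewrite em; move: Ft; rewrite e => /factor_behead/factor_belast.
Qed.

(** Every palindrome is the middle of a longer one. *)
Lemma palindromes_le u n :
    ~ eventually_periodic u ->
    factor_complexity u n.+1 <= (factor_complexity u n).+1 ->
    rev_closed u n.+1 ->
  #|palindromes u n| <= #|palindromes u n.+2|.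
Proof.
move=> nper leC cl; apply: leq_trans (leq_imset_card (@middle_tuple n) _).
apply/subset_leq_card/subsetP => t; rewrite inE => /andP[/mem_factors Ft /eqP pal].
have [x Fx] := palindrome_extension nper leC cl (size_tuple t) Ft pal.
pose s := [tuple of x :: rcons t x].
apply/imsetP; exists s; last by apply/val_inj/esym/(@middle_tuple_cons _ s).
rewrite inE; apply/andP; split; first exact/mem_factors.
by rewrite /= rev_cons rev_rcons pal.
Qed.

(** If x and y were distinct, then w would be the right special word of length n,
hence the tail of the right special word t w of length n + 1; say t = x.
Then x w y is a factor, and so is its reversal y w x, which makes y w a second
right special word of length n + 1. *)
Lemma palindrome_extension_uniq u n w x y :
    ~ eventually_periodic u ->
    factor_complexity u n.+1 <= (factor_complexity u n).+1 ->
    factor_complexity u n.+2 <= (factor_complexity u n.+1).+1 ->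
    rev_closed u n.+2 -> size w = n -> rev w = w ->
    is_factor u (x :: rcons w x) -> is_factor u (y :: rcons w y) ->
  x = y.
Proof.
move=> nper leC leC' cl wn pal Fx Fy.
have revF a b : is_factor u (a :: rcons w b) -> is_factor u (b :: rcons w a).
  by move/cl; rewrite /= size_rcons wn rev_cons rev_rcons pal; apply.
have [[//|t w'] /= [wn'] [a [b [nab Fa Fb]]]] := aperiodic_right_special n.+1 nper.
wlog nxy : / x != y by move=> IH; case: (eqVneq x y) => [//|/IH].
have ew : w' = w.
  apply: (right_special_uniq leC) => //.
    by exists a, b; split=> //; [move: Fa | move: Fb]; apply: factor_behead.
  by exists x, y; split=> //; [move: Fx | move: Fy]; apply: factor_behead.
subst w'; have exy c : is_factor u (rcons w c) -> c = x \/ c = y.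
  by apply: (right_special_ext leC wn nxy); [move: Fx | move: Fy]; apply: factor_behead.
have ht : t = x \/ t = y.
  apply/exy/(@factor_behead _ _ _ a); rewrite -[a :: _]/(a :: rcons w t); exact: revF.
wlog et : x y Fx Fy nxy exy ht / t = x.
  move=> IH; case: (ht) => [|e]; first exact: IH.
  apply/esym/(IH y x Fy Fx _ _ _ e); last by left.
    by rewrite eq_sym.
  by move=> c /exy[]; auto.
have Fxy : is_factor u (x :: rcons w y).
  rewrite -et; case: (exy _ (factor_behead Fa)) => [ea|<- //].
  by case: (exy _ (factor_behead Fb)) nab => [->|<- //]; rewrite ea eqxx.
suff [] : x :: w = y :: w by [].
apply: (right_special_uniq leC'); rewrite /= ?wn //; exists x, y; split=> //.
exact: revF.
Qed.

Lemma palindromes_ge u n :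
    ~ eventually_periodic u ->
    factor_complexity u n.+1 <= (factor_complexity u n).+1 ->
    factor_complexity u n.+2 <= (factor_complexity u n.+1).+1 ->
    rev_closed u n.+2 ->
  #|palindromes u n.+2| <= #|palindromes u n|.
Proof.
move=> nper leC leC' cl.
rewrite -(card_in_imset (f := @middle_tuple n) (D := palindromes u n.+2)).
  exact: subset_leq_card (middle_palindrome u n).
move=> s t; rewrite inE => /andP[/mem_factors Fs /eqP/palindrome_split[x [w [es pal]]]].
rewrite inE => /andP[/mem_factors Ft /eqP/palindrome_split[y [w' [et _]]]].
have ews := middle_tuple_cons es; have ewt := middle_tuple_cons et.
move=> e; have ew : w' = w by rewrite -ews -ewt e.
rewrite es in Fs; rewrite et ew in Ft.
apply: val_inj; rewrite [LHS]es [RHS]et ew.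
rewrite (palindrome_extension_uniq nper leC leC' cl _ pal Fs Ft) //.
by rewrite -ews size_tuple.
Qed.

End Palindromes.

(** * Sturmian sequences *)

Section Sturmian.
Variable A : finType.
Implicit Types (u v : nat -> A) (w : seq A) (x y z : A).

(** The word x w is the right special word of length n + 1. Let y w y occur at
position k. An occurrence of x w at k + i with 0 < i <= n would overlap it, with
its first letter x as the letter w_(i-1), and with w_(n-i) placed on the last y;
as w is a palindrome these two letters are equal. So none of the n + 2 windows
of length n + 1 from k to k + n + 1 is x w. They take at most n + 1 values,
hence one of them repeats, with no right special word in between. *)
Lemma unbalanced_periodic u n w x y :
    factor_complexity u n.+1 <= n.+2 ->
    factor_complexity u n.+2 <= (factor_complexity u n.+1).+1 ->
    size w = n -> rev w = w -> x != y ->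
    is_factor u (x :: rcons w x) -> is_factor u (x :: rcons w y) ->
    is_factor u (y :: rcons w y) ->
  eventually_periodic u.
Proof.
move=> leC leC' wn pal nxy Fxx Fxy [k].
rewrite [size _]/= size_rcons wn => yky.
have sxw : right_special u (x :: w) by exists x, y.
have ky : u k = y.
  by have := congr1 (nth x ^~ 0) yky; rewrite nth_window //= addn0.
have kw j : j < n -> u (k + j.+1) = nth x w j.
  move=> ltj; have := congr1 (nth x ^~ j.+1) yky.
  by rewrite nth_window ?ltnS 1?ltnW //= nth_rcons wn ltj.
have kn : u (k + n.+1) = y.
  have := congr1 (nth x ^~ n.+1) yky.
  by rewrite nth_window //= nth_rcons wn ltnn eqxx.
(* The window at k + i is x w for no i: the end positions i = 0 and i = n + 1
   carry the letter y, and in between w overlaps with itself. *)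
have avoid i : i <= n.+1 -> window u (k + i) n.+1 != x :: w.
  move=> lei; apply/eqP => e.
  have ix : u (k + i) = x.
    by have := congr1 (nth x ^~ 0) e; rewrite nth_window //= addn0.
  have iw j : j < n -> u (k + i + j.+1) = nth x w j.
    by move=> ltj; have := congr1 (nth x ^~ j.+1) e; rewrite nth_window.
  case: i => [|i] in lei e ix iw *; first by rewrite -ix addn0 ky eqxx in nxy.
  move: lei; rewrite ltnS leq_eqVlt => /predU1P[ei|lti].
    by rewrite -ix ei kn eqxx in nxy.
  have := kw _ lti; rewrite ix -{1}pal nth_rev wn //.
  have lt' : n - i.+1 < n by lia.
  rewrite -(iw _ lt') (_ : k + i.+1 + _ = k + n.+1); last by lia.
  by rewrite kn => exy; rewrite exy eqxx in nxy.
pose S := [set t in factors u n.+1 | tval t != x :: w].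
have [i||i [j [/andP[ij ltj] eij]]] :=
  @pigeonhole _ S (fun i => factor_at u (k + i) n.+1) n.+2.
- rewrite ltnS => lei; rewrite inE val_factor_at avoid // andbT.
  by apply/mem_factors; rewrite val_factor_at; apply: factor_window.
- move/eqP: wn => wn; apply: leq_trans leC.
  apply: proper_card; apply/properP; split.
    by apply/subsetP => t; rewrite inE => /andP[].
  exists [tuple of x :: Tuple wn].
    exact/mem_factors/(@factor_belast _ u (x :: w) x).
  by rewrite inE eqxx andbF.
apply: (@determined_periodic _ u n.+1 (k + i) (k + j)); first by rewrite ltn_add2l.
  by rewrite -!val_factor_at eij.
move=> l m /andP[il lj]; apply: determined_special => sl.
have : window u (k + (l - k)) n.+1 != x :: w by apply: avoid; lia.
rewrite subnKC; last by lia.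
case/eqP; apply: (right_special_uniq leC') => //; first by rewrite size_window.
by rewrite /= wn.
Qed.

Lemma sturmian_aperiodic u : sturmian u -> ~ eventually_periodic u.
Proof. by move=> st /periodic_bounded[B] /(_ B); rewrite st; lia. Qed.

Lemma sturmian_complexityS u n :
  sturmian u -> factor_complexity u n.+1 <= (factor_complexity u n).+1.
Proof. by move=> st; rewrite !st; lia. Qed.

(** The shifted sequence is not eventually periodic either, so it has at least
n + 1 factors of length n, that is, all those of u. *)
Lemma sturmian_recurrent u w :
  sturmian u -> is_factor u w -> exists x, is_factor u (x :: w).
Proof.
move=> st; pose v i := u i.+1.
have Fv (z : seq A) : is_factor v z -> exists x, is_factor u (x :: z).
  by case=> i zi; exists (u i), i; rewrite /= window_cons; congr cons; apply: zi.
have nperv : ~ eventually_periodic v.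
  move=> [N [p [p_gt0 per]]]; apply: (sturmian_aperiodic st).
  by exists N.+1, p; split=> // k; rewrite !addSn; apply: per.
pose n := size w; have wn : size w == n by [].
have sub : factors v n \subset factors u n.
  apply/subsetP => t /mem_factors/Fv[x /factor_behead Ft]; exact/mem_factors.
have e : factors v n = factors u n.
  apply/eqP; rewrite eqEcard sub; have := complexity_ge n nperv.
  by rewrite /factor_complexity [#|factors u n|]st addn1.
move=> Fw; apply: Fv.
by apply/(mem_factors _ (Tuple wn)); rewrite e; apply/mem_factors.
Qed.

(** By induction on the length. Let x w y be a factor. By induction y rev(w) and
rev(w) x are factors; the extension y rev(w) x is forced unless y rev(w) also
continues with some z other than x, and rev(w) x is also preceded by some z'
other than y. In that case both w and rev(w) are right special, so w is a
palindrome with extensions x and y only, and x w x, x w y, y w y are factors: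
this is excluded by [unbalanced_periodic]. *)
Lemma sturmian_rev_closed u n : sturmian u -> rev_closed u n.
Proof.
move=> st; have nper := sturmian_aperiodic st.
suff : rev_closed u n.+1 by apply: rev_closed_pred.
elim: n => [|n cl].
  by move=> [|a []] //.
have cl' := rev_closed_pred cl.
move=> [//|x s]; case/lastP: s => [|w y] /=; rewrite ?size_rcons.
  by [].
move=> [wn] Fxy; rewrite rev_cons rev_rcons.
have Fyw : is_factor u (y :: rev w).
  by rewrite -rev_rcons; apply: cl; rewrite ?size_rcons ?wn //; apply: factor_behead Fxy.
have Fwx : is_factor u (rcons (rev w) x).
  rewrite -rev_cons; apply: cl; first by rewrite /= wn.
  exact: (factor_belast (Fxy : is_factor u (rcons (x :: w) y))).
have [z Fz] := factor_rext Fyw.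
have [ezx|nzx] := eqVneq z x; first by rewrite ezx in Fz.
have srw : right_special u (rev w).
  by exists z, x; split=> //; apply: factor_behead Fz.
have [z' Fz'] := sturmian_recurrent st Fwx.
have [ezy|nzy] := eqVneq z' y; first by rewrite ezy in Fz'.
have sw : right_special u w.
  exists z', y; split=> //; last exact: factor_behead Fxy.
  rewrite -[w]revK -rev_cons; apply: cl; first by rewrite /= size_rev wn.
  exact: (factor_belast (Fz' : is_factor u (rcons (z' :: rev w) x))).
have pal : rev w = w.
  by apply: (right_special_uniq (sturmian_complexityS n st)); rewrite ?size_rev.
rewrite pal in Fyw Fwx Fz Fz' *.
have [exy|nxy] := eqVneq x y; first by rewrite exy in Fxy *.
have ext c : is_factor u (rcons w c) -> c = x \/ c = y.
  apply: (right_special_ext (sturmian_complexityS n st) wn nxy) => //.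
  exact: factor_behead Fxy.
have ezy : z = y by case: (ext z (factor_behead Fz)) nzx => // ->; rewrite eqxx.
have ezx : z' = x.
  have : is_factor u (rcons w z').
    rewrite -{1}pal -rev_cons; apply: cl; first by rewrite /= wn.
    exact: (factor_belast (Fz' : is_factor u (rcons (z' :: w) x))).
  by case/ext => // e; rewrite e eqxx in nzy.
subst z z'; case: nper.
apply: (unbalanced_periodic _ (sturmian_complexityS n.+1 st) wn pal nxy) => //.
by rewrite st addn1.
Qed.

Lemma sturmian_reflection_complexity u n : sturmian u ->
  reflection_complexity u (n + 2) = reflection_complexity u n + 1.
Proof.
move=> st; have nper := sturmian_aperiodic st.
have cl m : rev_closed u m by apply: sturmian_rev_closed.
have leC m := sturmian_complexityS m st.
have := palindromes_le nper (leC n) (cl _).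
have := palindromes_ge nper (leC n) (leC n.+1) (cl _).
have := double_reflection_complexity_closed (cl n).
have := double_reflection_complexity_closed (cl n.+2).
by rewrite !st addn2; lia.
Qed.

Lemma reflection_complexity_aperiodic u :
    (forall n, reflection_complexity u (n + 2) = reflection_complexity u n + 1) ->
  ~ eventually_periodic u.
Proof.
move=> hr /periodic_bounded[B leB].
have : forall n, n <= reflection_complexity u (n * 2).
  elim=> [//|n IHn]; by rewrite mulSn addnC hr addn1.
have := reflection_complexity_le u (B.+1 * 2); have := leB (B.+1 * 2).
by move=> ? ? /(_ B.+1); lia.
Qed.

(** The induction proves C(n) = n + 1 together with closure under reversal, for
two consecutive lengths: from n and n + 1 one gets P(n) <= P(n + 2), which
bounds the number of factors of length n + 2 and their reversals by n + 3. *)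
Lemma binary_sturmian u :
    (forall n, reflection_complexity u (n + 2) = reflection_complexity u n + 1) ->
    factor_complexity u 1 = 2 ->
  sturmian u.
Proof.
move=> hr C1; have nper := reflection_complexity_aperiodic hr.
suff H n : (factor_complexity u n = n + 1 /\ rev_closed u n) /\
           (factor_complexity u n.+1 = n.+1 + 1 /\ rev_closed u n.+1).
  by move=> n; case: (H n) => -[].
elim: n => [|n [[Cn cln] [Cn1 cln1]]].
  split; last by split=> // -[|a []].
  split; last by case.
  have := complexity_ltS 0 nper; have := complexity_ge 0 nper; lia.
split=> //.
have leC : factor_complexity u n.+1 <= (factor_complexity u n).+1 by lia.
have := palindromes_le nper leC cln1.
have := double_reflection_complexity_closed cln.
have := double_reflection_complexity u n.+2.
have := hr n; rewrite addn2 => -> e1 e2 leP.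
have ge := complexity_ge n.+2 nper.
have le : factor_complexity u n.+2 <=
    #|factors u n.+2 :|: @rev_t A n.+2 @: factors u n.+2|.
  exact/subset_leq_card/subsetUl.
split; first by lia.
by apply: rev_closed_card; lia.
Qed.

End Sturmian.

(** * Sequences in which every other letter is fixed *)

(** This is pi(v) for b = false and c pi(v) for b = true. *)
Definition weave (A : Type) (b : bool) (c : A) (v : nat -> A) : nat -> A :=
  fun n => if odd n (+) b then c else v n./2.

Section Weave.
Variables (A : finType) (c : A).
Implicit Types (u v : nat -> A) (w s : seq A) (b : bool).

(** The word of length n that starts with c if and only if b holds, and whose
remaining letters are read from s. The default value c is reached only when s
is too short. *)
Definition weave_tuple b n s : n.-tuple A := factor_at (weave b c (nth c s)) 0 n.

Lemma nth_weave_tuple b n s j : j < n ->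
  nth c (weave_tuple b n s) j = if odd j (+) b then c else nth c s j./2.
Proof. by move=> ltj; rewrite val_factor_at nth_window. Qed.

(** The parity of the position decides whether a window starts with c. Its other
letters form a window of v that starts at i / 2, rounded up for pi(v) and down
for c pi(v). *)
Lemma window_weave b v i n m : n <= m.*2 + (b (+) odd i) ->
  window (weave b c v) i n =
    weave_tuple (b (+) odd i) n (window v (i./2 + (odd i && ~~ b)) m).
Proof.
move=> len; apply: (@eq_from_nth _ c) => [|j]; rewrite size_window ?size_tuple // => ltj.
rewrite nth_weave_tuple // nth_window // /weave.
have -> : odd (i + j) (+) b = odd j (+) (b (+) odd i).
  by rewrite oddD addbC addbA addbC.
case: ifP => // jc; rewrite nth_window; first by congr v; lia.
by move: jc len ltj; lia.
Qed.

(** In even length exactly one end is c, in odd length both ends are c or none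
is: this is why reversal exchanges the two types of words here, and preserves
them in the next lemma. *)
Lemma rev_weave_tuple_even b m s : size s = m ->
  rev (weave_tuple b m.*2 s) = weave_tuple (~~ b) m.*2 (rev s).
Proof.
move=> sm; apply: (@eq_from_nth _ c) => [|j]; rewrite size_rev ?size_tuple // => ltj.
rewrite nth_rev ?size_tuple // !nth_weave_tuple //; last by lia.
have -> : odd (m.*2 - j.+1) = ~~ odd j by lia.
rewrite addNb -addbN; case: ifP => // jc; rewrite nth_rev; last by lia.
by congr nth; lia.
Qed.

Lemma rev_weave_tuple_odd b m s : size s = m + ~~ b ->
  rev (weave_tuple b m.*2.+1 s) = weave_tuple b m.*2.+1 (rev s).
Proof.
move=> sm; apply: (@eq_from_nth _ c) => [|j]; rewrite size_rev ?size_tuple // => ltj.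
rewrite nth_rev ?size_tuple // !nth_weave_tuple //; last by lia.
have -> : odd (m.*2.+1 - j.+1) = odd j by lia.
case: ifP => // jc; rewrite nth_rev; last by lia.
by congr nth; lia.
Qed.

Lemma weave_tuple_inj b n s s' : size s = size s' -> (size s).*2 <= n + ~~ b ->
  weave_tuple b n s = weave_tuple b n s' -> s = s'.
Proof.
move=> es len e; apply: (@eq_from_nth _ c) => // k ltk.
have lt : k.*2 + b < n by lia.
have := congr1 (fun t : n.-tuple A => nth c t (k.*2 + b)) e.
rewrite !nth_weave_tuple // oddD odd_double oddb addbb.
by have -> : (k.*2 + b)./2 = k by lia.
Qed.

Section Avoid.
Variable v : nat -> A.
Hypothesis vc : forall i, v i != c.

Lemma weave_tuple_disjoint n s s' : 0 < n -> 0 < size s -> is_factor v s ->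
  weave_tuple false n s <> weave_tuple true n s'.
Proof.
move=> n_gt0 s_gt0 [i si] e.
have := congr1 (fun t : n.-tuple A => nth c t 0) e.
rewrite !nth_weave_tuple //= si nth_window // => /eqP.
by rewrite (negPf (vc _)).
Qed.

(** Two nonempty words of even length that start with letters of v cannot be the
reversal of each other, because the reversal starts with c. *)
Lemma weave_even_inj m : {in factors v m &,
  injective (fun s : m.-tuple A => refl_class (weave_tuple false m.*2 s))}.
Proof.
move=> s s' /mem_factors Fs _ /eqP; rewrite refl_classE => /orP[/eqP/val_inj|/eqP].
  by move/weave_tuple_inj=> e; apply/val_inj/e; rewrite ?size_tuple //; lia.
rewrite rev_weave_tuple_even ?size_tuple // => /val_inj/weave_tuple_disjoint.
case: (posnP m) s s' Fs => [->|m_gt0] s s' Fs; first by rewrite (tuple0 s) (tuple0 s').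
by case; rewrite ?size_tuple //; lia.
Qed.

Lemma factor_weave b m n s : n <= m.*2 -> size s = m -> is_factor v s ->
  is_factor (weave b c v) (weave_tuple false n s).
Proof.
move=> len sm [i si]; exists (i.*2 + b); rewrite size_tuple.
rewrite (@window_weave _ _ _ _ m); last by lia.
rewrite oddD odd_double oddb addbb si sm.
by have -> : (i.*2 + b)./2 + (b && ~~ b) = i by lia.
Qed.

Lemma complexity_le_weave b m :
  factor_complexity v m <= reflection_complexity (weave b c v) m.*2.
Proof.
rewrite reflection_complexityE /factor_complexity -(card_in_imset (@weave_even_inj m)).
apply/subset_leq_card/subsetP => _ /imsetP[s /mem_factors Fs ->].
by apply/imset_f/mem_factors; apply: (factor_weave b _ (size_tuple s)).
Qed.

Hypothesis st : sturmian v.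

(** In pi(v) the first letter of v is not preceded by c. Recurrence of v
provides an occurrence of s at a positive position, which is preceded by c in
either sequence. *)
Lemma sturmian_factor_weave b b' m n s :
    n <= m.*2 + b' -> size s = m -> is_factor v s ->
  is_factor (weave b c v) (weave_tuple b' n s).
Proof.
move=> len sm /(sturmian_recurrent st)[x [i]].
rewrite /= window_cons => -[_ si].
pose j := i.+1.*2 + (b (+) b') - (b' && ~~ b).*2.
have jb : b (+) odd j = b' by rewrite /j; case: (b) (b') => -[] /=; lia.
suff -> : weave_tuple b' n s = window (weave b c v) j n :> seq A.
  exact: factor_window.
rewrite (@window_weave _ _ _ _ m) ?jb // {1}si sm.
congr (tval (weave_tuple _ _ (window _ _ _))).
by rewrite /j; case: (b) (b') => -[] /=; lia.
Qed.

(** Each class has a representative that starts with a letter of v. *)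
Lemma reflection_complexity_weave_even b m :
  reflection_complexity (weave b c v) m.*2 = factor_complexity v m.
Proof.
rewrite reflection_complexityE /factor_complexity -(card_in_imset (@weave_even_inj m)).
congr #|pred_of_set _|; apply/setP => C.
apply/imsetP/imsetP => [[t /mem_factors[i ti] ->]|[s /mem_factors Fs ->]].
  pose k := i./2 + (odd i && ~~ b).
  have Fk : factor_at v k m \in factors v m.
    by apply/mem_factors; rewrite val_factor_at; apply: factor_window.
  have et : t = weave_tuple (b (+) odd i) m.*2 (factor_at v k m).
    apply: val_inj; rewrite [LHS]ti size_tuple (@window_weave _ _ _ _ m) ?leq_addr //.
    by rewrite val_factor_at.
  rewrite et; case: (b (+) odd i); last by exists (factor_at v k m).
  exists (rev_t (factor_at v k m)).
    apply/mem_factors; apply: (sturmian_rev_closed (n := m) st); first exact: size_tuple.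
    exact/mem_factors.
  rewrite -[RHS]refl_class_rev; congr refl_class; apply: val_inj.
  by rewrite [RHS]rev_weave_tuple_even ?revK // size_rev size_tuple.
exists (weave_tuple false m.*2 s) => //; apply/mem_factors.
by apply: (@sturmian_factor_weave _ _ m); rewrite ?size_tuple ?addn0.
Qed.

Lemma card_weave_odd b' m :
  #|(fun s : (m + ~~ b').-tuple A => refl_class (weave_tuple b' m.*2.+1 s))
      @: factors v (m + ~~ b')| = reflection_complexity v (m + ~~ b').
Proof.
rewrite reflection_complexityE; apply: card_imset_kernel => s s' _ _.
rewrite !refl_classE /refl_equiv rev_weave_tuple_odd ?size_tuple //.
have inj (x y : seq A) : size x = m + ~~ b' -> size y = m + ~~ b' ->
    (weave_tuple b' m.*2.+1 x == weave_tuple b' m.*2.+1 y :> seq A) = (x == y).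
  move=> sx sy; apply/eqP/eqP => [/val_inj/weave_tuple_inj|->//].
  by apply; rewrite ?sx ?sy //; case: b' {sx sy s s'}; lia.
by rewrite !inj ?size_rev ?size_tuple.
Qed.

(** The words that start and end with c carry the factors of v of length m, the
other ones those of length m + 1; both correspondences commute with reversal. *)
Lemma reflection_complexity_weave_odd b m :
  reflection_complexity (weave b c v) m.*2.+1 =
    reflection_complexity v m + reflection_complexity v m.+1.
Proof.
have := card_weave_odd false m; have := card_weave_odd true m.
rewrite /= addn0 addn1 => <- <-; rewrite reflection_complexityE.
set Xt := imset _ (mem (factors v m)); set Xf := imset _ (mem (factors v m.+1)).
have -> : @refl_class A m.*2.+1 @: factors (weave b c v) m.*2.+1 = Xt :|: Xf.
  apply/setP => C; rewrite in_setU; apply/imsetP/orP => [[t /mem_factors[i ti] ->]|].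
    pose k := i./2 + (odd i && ~~ b).
    have Fk j : factor_at v k j \in factors v j.
      by apply/mem_factors; rewrite val_factor_at; apply: factor_window.
    have et j : m.*2.+1 <= j.*2 + (b (+) odd i) ->
        t = weave_tuple (b (+) odd i) m.*2.+1 (factor_at v k j).
      move=> le; apply: val_inj; rewrite [LHS]ti size_tuple (@window_weave _ _ _ _ j) //.
      by rewrite val_factor_at.
    move: et; case: (b (+) odd i) => et; [left | right]; apply/imsetP.
      exists (factor_at v k m); first exact: Fk.
      by rewrite (et m) // addn1.
    exists (factor_at v k m.+1); first exact: Fk.
    by rewrite (et m.+1) // addn0 doubleS.
  case=> /imsetP[s /mem_factors Fs ->].
    exists (weave_tuple true m.*2.+1 s) => //; apply/mem_factors.
    by apply: (@sturmian_factor_weave _ _ m); rewrite ?size_tuple ?addn1.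
  exists (weave_tuple false m.*2.+1 s) => //; apply/mem_factors.
  by apply: (@sturmian_factor_weave _ _ m.+1); rewrite ?size_tuple ?addn0.
rewrite cardsU (_ : Xt :&: Xf = set0) ?cards0 ?subn0 //.
apply/setP => C; rewrite in_setI in_set0; apply/negP => /andP[/imsetP[s _ ->]].
case/imsetP => s' /mem_factors Fs' /esym/eqP; rewrite refl_classE.
case/orP => /eqP; last rewrite rev_weave_tuple_odd ?size_tuple ?addn0 //.
  by move/val_inj/weave_tuple_disjoint; apply; rewrite ?size_tuple.
by move/val_inj/weave_tuple_disjoint; apply; rewrite ?size_tuple.
Qed.

Lemma weave_sturmian_reflection b n :
  reflection_complexity (weave b c v) (n + 2) = reflection_complexity (weave b c v) n + 1.
Proof.
rewrite -(odd_double_half n); case: (odd n); rewrite ?add1n ?add0n.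
  have -> : n./2.*2.+1 + 2 = n./2.+1.*2.+1 by lia.
  rewrite !reflection_complexity_weave_odd.
  by have := sturmian_reflection_complexity n./2 st; rewrite addn2; lia.
have -> : n./2.*2 + 2 = n./2.+1.*2 by lia.
by rewrite !reflection_complexity_weave_even !st; lia.
Qed.

End Avoid.

Lemma weave_periodic b v : eventually_periodic v -> eventually_periodic (weave b c v).
Proof.
case=> N [p [p_gt0 per]]; exists N.*2, p.*2; split=> [|k]; first by lia.
rewrite /weave !oddD !odd_double addbF; case: ifP => // _.
have -> : (N.*2 + (k + p.*2))./2 = N + (k./2 + p) by lia.
by rewrite per; congr v; lia.
Qed.

Lemma weave_sturmian b v :
    (forall i, v i != c) ->
    (forall n, reflection_complexity (weave b c v) (n + 2) =
       reflection_complexity (weave b c v) n + 1) ->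
  sturmian v.
Proof.
move=> vc hr m.
have nper : ~ eventually_periodic v.
  by move/(weave_periodic b); apply: reflection_complexity_aperiodic.
have r0 : reflection_complexity (weave b c v) 0 <= 1.
  rewrite reflection_complexityE (leq_trans (leq_imset_card _ _)) //.
  by rewrite (leq_trans (max_card _)) // card_tuple.
have rm : reflection_complexity (weave b c v) m.*2 <= m + 1.
  elim: m => // m IHm; rewrite doubleS -addn2 hr; lia.
by have := complexity_ge m nper; have := complexity_le_weave vc b m; lia.
Qed.

Lemma morph_seq_pi v : morph_seq (pi_morph c) v =1 weave false c v.
Proof.
move=> n; rewrite /morph_seq /weave addbF.
have nthpi (s : seq A) d k : k < (size s).*2 ->
    nth d (morph (pi_morph c) s) k = if odd k then c else nth d s k./2.
  elim: s k => [|x s IHs] // [|[|k]] //= ltk.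
  by rewrite negbK IHs.
rewrite nthpi; last by rewrite size_mkseq; lia.
by case: ifP => // _; rewrite nth_mkseq //; lia.
Qed.

Lemma scons_morph_seq_pi v : scons c (morph_seq (pi_morph c) v) =1 weave true c v.
Proof.
case=> // n; rewrite /= morph_seq_pi /weave /= uphalf_half addbF addbT negbK.
by case: (odd n).
Qed.

End Weave.

(** * The letters of a sequence with two classes of factors of length two *)

Section Letters.
Variable A : finType.
Implicit Types (u : nat -> A).

(** Two inequivalent pairs represent all the classes when there are only two. *)
Lemma two_pair_classes u i j k :
    reflection_complexity u 2 = 2 ->
    ~~ refl_equiv (window u i 2) (window u j 2) ->
  refl_equiv (window u k 2) (window u i 2) || refl_equiv (window u k 2) (window u j 2).
Proof.
rewrite reflection_complexityE -!val_factor_at -!refl_classE => r2 nij.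
have F l : refl_class (factor_at u l 2) \in @refl_class A 2 @: factors u 2.
  by apply/imset_f/mem_factors; rewrite val_factor_at; apply: factor_window.
rewrite -in_set2 (_ : [set _; _] = @refl_class A 2 @: factors u 2) //.
by apply/eqP; rewrite eqEcard subUset !sub1set !F r2 cards2 nij.
Qed.

(** If u_i = u_{i+1}, this pair is one class. The other class is a pair of two
distinct letters, one of which is u_i, since otherwise u never leaves u_i. If
there is no such i, then u has three consecutive distinct letters a, c, b, since
otherwise its period is 2; then every adjacent pair contains c exactly once. *)
Lemma letters_dichotomy u :
    ~ eventually_periodic u -> reflection_complexity u 2 = 2 ->
  factor_complexity u 1 = 2 \/
  exists a b c beta v, [/\ a != b, c \notin [:: a; b],
    forall i, v i \in [:: a; b] & u = weave beta c v].
Proof.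
move=> nper r2.
have wE i : window u i 2 = [:: u i; u i.+1] by rewrite !window_cons.
have pairE (x y z t : A) : refl_equiv [:: x; y] [:: z; t] =
    (x == z) && (y == t) || (x == t) && (y == z).
  by rewrite /refl_equiv /= !eqseq_cons !andbT.
have pairs i j k : ~~ refl_equiv [:: u i; u i.+1] [:: u j; u j.+1] ->
    refl_equiv [:: u k; u k.+1] [:: u i; u i.+1] ||
    refl_equiv [:: u k; u k.+1] [:: u j; u j.+1].
  by rewrite -!wE; apply: two_pair_classes.
have [[i eii]|nsq] := pselect (exists i, u i.+1 = u i).
  have [j njj] : exists j, u j.+1 != u j.
    apply: contrapT => /forallNP cst; apply: nper; exists 0, 1; split=> // k.
    by rewrite !add0n addn1; apply/eqP/negPn/negP/cst.
  have {}pairs k : [|| (u k == u i) && (u k.+1 == u i),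
      (u k == u j) && (u k.+1 == u j.+1) | (u k == u j.+1) && (u k.+1 == u j)].
    have := pairs i j k; rewrite eii !pairE orbb; apply.
    by rewrite andbC orbb; apply: contra njj => /andP[/eqP<- /eqP<-].
  have ij : (u i == u j) || (u i == u j.+1).
    apply: contrapT => /negP; rewrite negb_or => /andP[/negPf n1 /negPf n2].
    apply: nper; exists i, 1; split=> // k.
    have e l : u (i + l) = u i.
      elim: l => [|l IHl]; first by rewrite addn0.
      by have := pairs (i + l); rewrite IHl n1 n2 /= orbF -addnS => /andP[_ /eqP].
    by rewrite !e.
  have {}pairs k : (u k == u j) || (u k == u j.+1).
    by case/or3P: (pairs k) => /andP[/eqP-> _]; rewrite ?eqxx ?orbT.
  left; rewrite /factor_complexity.
  rewrite (_ : factors u 1 = (fun x => [tuple x]) @: [set u j; u j.+1]).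
    by rewrite card_imset => [|x y [] //]; rewrite cards2 eq_sym njj.
  apply/setP => t; apply/idP/imsetP => [|[x]].
    move/mem_factors => [k]; rewrite size_tuple => tk; exists (u k).
      by rewrite !inE pairs.
    by apply: val_inj; rewrite [LHS]tk window_cons.
  rewrite !inE => /orP[]/eqP-> -> /=; apply/asboolP; [exists j | exists j.+1];
    by apply: val_inj; rewrite [RHS]val_factor_at window_cons.
right.
have {}nsq k : u k.+1 != u k by apply/eqP => e; apply: nsq; exists k.
have [i ni] : exists i, u i.+2 != u i.
  apply: contrapT => /forallNP cst; apply: nper; exists 0, 2; split=> // k.
  by rewrite !add0n addn2; apply/eqP/negPn/negP/cst.
pose a := u i; pose c := u i.+1; pose b := u i.+2.
have nac : a == c = false by rewrite eq_sym; exact: negPf (nsq i).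
have nbc : b == c = false by exact: negPf (nsq i.+1).
have nab : a == b = false by rewrite eq_sym; exact: negPf ni.
have {}pairs k : [|| (u k == a) && (u k.+1 == c), (u k == c) && (u k.+1 == a),
    (u k == c) && (u k.+1 == b) | (u k == b) && (u k.+1 == c)].
  have := pairs i i.+1 k; rewrite !pairE -/a -/b -/c nac nab /=.
  by move/(_ isT); rewrite -!orbA.
have step k : (u k.+1 == c) = ~~ (u k == c).
  by case/or4P: (pairs k) => /andP[/eqP-> /eqP->]; rewrite ?eqxx ?nac ?nbc.
have abc k : u k != c -> u k \in [:: a; b].
  by case/or4P: (pairs k) => /andP[/eqP-> _]; rewrite ?eqxx // !inE eqxx ?orbT.
pose beta := u 0 != c.
have uc k : (u k == c) = odd k (+) ~~ beta.
  rewrite negbK; elim: k => // k IHk.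
  by rewrite step IHk /= addNb.
exists a, b, c, (~~ beta), (fun k => u (k.*2 + ~~ beta)); split.
- by rewrite nab.
- by rewrite !inE ![c == _]eq_sym nac nbc.
- by move=> k; apply: abc; rewrite uc oddD odd_double oddb addbb.
apply/funext => n; rewrite /weave; case: ifP => [h|/negP/negP h].
  by apply/eqP; rewrite uc.
by rewrite {1}(_ : n = n./2.*2 + ~~ beta) //; move: h; case: (beta) => /=; lia.
Qed.

End Letters.

(** * The characterization *)

Theorem theorem18 (A : finType) (u : nat -> A) :
  (forall n : nat,
     reflection_complexity u (n + 2) = reflection_complexity u n + 1)
  <->
  (sturmian u \/
   exists (a b c : A) (v : nat -> A),
     [/\ a != b,
         (forall i, v i \in [:: a; b]),
         sturmian v,
         c \notin [:: a; b]
       & u =1 morph_seq (pi_morph c) v \/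
         u =1 scons c (morph_seq (pi_morph c) v)]).
Proof.
have avoid (a b c : A) (v : nat -> A) : (forall i, v i \in [:: a; b]) ->
    c \notin [:: a; b] -> forall i, v i != c.
  by move=> vab cab i; apply: contraNneq cab => <-.
split=> [hr|[st|[a [b [c [v [nab vab st cab uv]]]]]] n].
- have nper := reflection_complexity_aperiodic hr.
  have r0 : reflection_complexity u 0 = 1.
    apply/eqP; rewrite eqn_leq (leq_trans (reflection_complexity_le u 0)) /=.
      rewrite reflection_complexityE; apply/card_gt0P.
      exists (refl_class (factor_at u 0 0)); apply/imset_f/mem_factors.
      by rewrite val_factor_at; apply: factor_window.
    by rewrite (leq_trans (max_card _)) // card_tuple.
  have [|C1|[a [b [c [beta [v [nab cab vab uE]]]]]]] := letters_dichotomy nper.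
  + by rewrite (hr 0) r0.
  + by left; apply: binary_sturmian.
  right; exists a, b, c, v; split=> //.
    by rewrite uE in hr; apply: weave_sturmian hr; apply: avoid cab.
  rewrite uE; case: beta {uE}; [right | left] => i.
    by rewrite scons_morph_seq_pi.
  by rewrite morph_seq_pi.
- exact: sturmian_reflection_complexity.
have vc := avoid _ _ _ _ vab cab.
case: uv => /funext ->.
  by rewrite (funext (morph_seq_pi c v)); apply: weave_sturmian_reflection.
by rewrite (funext (scons_morph_seq_pi c v)); apply: weave_sturmian_reflection.
Qed.
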